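(* Let $G$ be a permutation group on a finite set $\Omega$ with $|\Omega|=n$, and let $k$ be a positive integer. (1) Suppose $G$ is intransitive and $2<k<n$. Then $G$ has the $k$-et property if and only if $G$ fixes a point of $\Omega$ and acts $(k-1)$-homogeneously on the remaining $n-1$ points. (2) If $G$ is transitive, $3<k<n-2$, and $G$ has the $k$-et property, then $G$ is primitive. (3) For each $k\ge 5$ there is an integer $N_k$ such that, whenever $n\ge N_k$ and $k\le n/2$, every transitive permutation group of degree $n$ with the $k$-et property is $2$-homogeneous.
   Context: A $k$-partition of $\Omega$ is a partition into exactly $k$ nonempty parts; a section (transversal) of it is a set containing exactly one point of each part. A permutation group $G$ on $\Omega$ has the $k$-existential transversal property ($k$-et) if there is a $k$-subset $S$ of $\Omega$ such that for every $k$-partition $\mathcal{P}$ of $\Omega$ there is $g\in G$ with $Sg$ a section of $\mathcal{P}$. $G$ is $m$-homogeneous on a set if it acts transitively on the $m$-element subsets of that set. *)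

(* Defs.v *)
From mathcomp Require Import all_boot all_fingroup all_solvable.

Set Implicit Arguments.
Unset Strict Implicit.
Unset Printing Implicit Defensive.

Definition k_partition (T : finType) (k : nat) (P : {set {set T}}) : bool :=
  partition P [set: T] && (#|P| == k).

Definition k_et (T : finType) (k : nat) (G : {group {perm T}}) : Prop :=
  exists S : {set T}, #|S| = k /\
    forall P : {set {set T}}, k_partition k P ->
      exists2 g : {perm T}, g \in G & is_transversal ('P^*%act S g) P [set: T].

(* As [transitive _, on set0 | _] is false in MathComp, so is
   [homogeneous m G D] when #|D| < m. *)
Definition homogeneous (T : finType) (m : nat) (G : {group {perm T}})
    (D : {set T}) : bool :=
  [transitive G, on [set A : {set T} | A \subset D & #|A| == m] | 'P^*].

(* Main.v *)
Require Import Defs.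
From mathcomp Require Import all_boot all_fingroup all_solvable.
From mathcomp Require Import zify.

(** Let S be a k-set witnessing the k-et property. Taking for partition the
    points of a (k-1)-set K and the rest of the domain shows that some translate
    of K is contained in S ([et_witness_cover]): up to one extra point, S contains
    every configuration of k-1 points. The three parts play this against
    invariants of G.

    (1) If G is intransitive, S meets each of two complementary invariant sets in
    as many points as k-1 points can. Since k is less than n, one of the two must
    be a point a that lies in S ([intransitive_k_et]). All (k-1)-sets avoiding a
    then have translates equal to S minus a, which is homogeneity. Conversely,
    every partition has a section through a ([homogeneous_k_et]).

    (2) Let l be the number of blocks of an invariant partition. A section of a
    partition coarser than the blocks has no two points in a block, and this
    forces l < k ([k_et_block_count_lt]); next, blocks have less than k-1 points
    ([k_et_block_size_lt]). Finally a partition finer than the blocks, with k-l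
    isolated points, can be chosen so that its sections either are too spread out
    to contain a block, or contain so much of each block that they cannot leave
    out two points in each of two blocks ([k_et_no_invariant_kernel]). Both are
    required, up to translation, of S, which may be taken to be such a section;
    the second requirement comes from n-k being at least 3.

    (3) A union of orbits of G on pairs is an invariant graph. By Ramsey it may be
    assumed to have a clique of size k-1, up to passing to the complement. So S
    is a clique and one more point and has no two disjoint non-edges. But a
    nonempty regular graph on at least four vertices, such as the complement if
    there is a non-edge, has two disjoint edges, and since k-1 is at least 4 they are
    covered by S ([et_witness_clique_complete]). Hence the graph is complete. *)

Set Implicit Arguments.
Unset Strict Implicit.
Unset Printing Implicit Defensive.

(** * Finite sets *)

Lemma exists_set_between (T : finType) (A B : {set T}) (m : nat) :
  A \subset B -> #|A| <= m <= #|B| ->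
  exists C : {set T}, [/\ A \subset C, C \subset B & #|C| = m].
Proof.
move=> sAB /andP[leAm]; rewrite -(subnKC leAm).
elim: (m - #|A|) => [|d IHd] ltB; first by exists A; rewrite addn0.
have [|C [sAC sCB cC]] := IHd; first by lia.
have [x Bx nCx] : exists2 x, x \in B & x \notin C.
  apply/subsetPn; apply: contraL ltB => /subset_leq_card; lia.
exists (x |: C); split; last by rewrite cardsU1 nCx cC; lia.
  by apply: subset_trans sAC (subsetUr _ _).
by rewrite subUset sub1set Bx.
Qed.

(** The fibres of [isolate X h] are the singletons in [X] and the traces of the
    fibres of [h] outside [X]. A section of this partition has to contain the
    whole of [X], which is how the partitions below control their sections. *)
Definition isolate (T U : finType) (X : {set T}) (h : T -> U) (x : T) : T + U :=
  if x \in X then inl x else inr (h x).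

(** The hypothesis on [h] says that [X] swallows no fibre of [h]; the domain [D]
    is kept general so that the blocks of an invariant partition, rather than
    points, can be isolated. *)
Lemma card_isolate (T U : finType) (D X : {set T}) (h : T -> U) :
  X \subset D -> h @: (D :\: X) = h @: D ->
  #|isolate X h @: D| = #|X| + #|h @: D|.
Proof.
move=> sXD eqh; rewrite -eqh.
have -> : isolate X h @: D = (inl @: X) :|: (inr @: (h @: (D :\: X))).
  rewrite -{1}(setID D X) (setIidPr sXD) imsetU -imset_comp; congr (_ :|: _).
    by apply: eq_in_imset => x Xx; rewrite /isolate Xx.
  by apply: eq_in_imset => x /setDP[_ /negPf nXx]; rewrite /isolate nXx.
have inlI : injective (@inl T U) by move=> ? ? [].
have inrI : injective (@inr T U) by move=> ? ? [].
rewrite cardsU disjoint_setI0 ?cards0 ?subn0.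
  by rewrite (card_imset _ inlI) (card_imset _ inrI).
rewrite disjoints_subset; apply/subsetP=> _ /imsetP[x _ ->].
by rewrite inE; apply/imsetP => -[].
Qed.

Lemma setact_perm (T : finType) (A : {set T}) (g : {perm T}) :
  'P^*%act A g = g @: A.
Proof. by apply: eq_imset => x; rewrite /= apermE. Qed.

(** In use, [S] is a witness and [K] a set that it covers: at most one point of
    [S] is not under control. *)
Lemma setD_imset_unique (T : finType) (k : nat) (S K : {set T}) (g : {perm T})
    (x y : T) :
  #|S| = k.+1 -> #|K| = k -> g @: K \subset S ->
  x \in S -> y \in S -> x \notin g @: K -> y \notin g @: K -> x = y.
Proof.
move=> cS cK sgK Sx Sy nx ny.
have /eqP/cards1P[s sE] : #|S :\: g @: K| = 1.
  have := cardsID (g @: K) S; rewrite (setIidPr sgK) card_imset ?cK ?cS; first lia.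
  exact: perm_inj.
have : x \in S :\: g @: K by rewrite inE nx.
have : y \in S :\: g @: K by rewrite inE ny.
by rewrite sE => /set1P-> /set1P->.
Qed.

(** * Witnesses and the sets they cover *)

(** A [k]-partition is presented as the fibres of a function with [k] values: a
    [k]-set is then a section exactly when the function is injective on it. *)
Definition et_witness (T : finType) (k : nat) (G : {group {perm T}})
    (S : {set T}) : Prop :=
  #|S| = k /\
  forall (U : finType) (f : T -> U), #|f @: [set: T]| = k ->
    exists2 g : {perm T}, g \in G & {in g @: S &, injective f}.

Lemma k_et_witness (T : finType) (k : nat) (G : {group {perm T}}) :
  k_et k G -> exists S, et_witness k G S.
Proof.
case=> S [cS etS]; exists S; split=> // U f cf.
pose P := preim_partition f [set: T].
have fP : partition P [set: T] by apply: preim_partitionP.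
have eqf x y : (f x == f y) = (y \in pblock P x).
  rewrite pblock_equivalence_partition ?inE // => u v w _ _ _.
  by split=> // /eqP->.
have [|g Gg trP] := etS P.
  rewrite /k_partition fP -cf.
  have -> : P = (fun u => f @^-1: [set u]) @: (f @: [set: T]).
    rewrite -imset_comp; apply: eq_imset => x /=.
    by apply/setP=> y; rewrite !inE eq_sym.
  apply/eqP/card_in_imset => _ _ /imsetP[x _ ->] /imsetP[y _ ->] /setP/(_ x).
  by rewrite !inE eqxx => /esym/eqP.
exists g => // x y Sx Sy /eqP; rewrite eqf => yx.
apply: (pblock_inj trP) => //.
by rewrite (same_pblock _ yx) //; case/and3P: fP.
Qed.

(** Moving a witness onto a section of a prescribed partition keeps it a witness,
    so that one may assume that the witness itself is a section. *)
Lemma et_witness_act (T : finType) (k : nat) (G : {group {perm T}})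
    (S : {set T}) (g : {perm T}) :
  et_witness k G S -> g \in G -> et_witness k G (g @: S).
Proof.
move=> [cS etS] Gg; split=> [|U f cf]; first by rewrite card_imset //; apply: perm_inj.
have [h Gh injf] := etS U f cf; exists (g^-1 * h)%g; first by rewrite groupM ?groupV.
suff -> : (g^-1 * h)%g @: (g @: S) = h @: S by [].
by rewrite -imset_comp; apply: eq_imset => x /=; rewrite permM permK.
Qed.

(** The partition into the points of [K] and the rest of the domain has only
    sections containing [K]. This necessary condition alone gives most of what
    follows. *)
Lemma et_witness_cover (T : finType) (k : nat) (G : {group {perm T}})
    (S K : {set T}) :
  et_witness k G S -> 0 < k <= #|T| -> #|K| = k.-1 ->
  exists2 g : {perm T}, g \in G & g @: K \subset S.
Proof.
move=> [cS etS] k_bnd cK.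
have [x nKx] : exists x, x \notin K.
  by apply/existsP; rewrite -negb_forall; apply/forallP=> allK; move: cK;
    rewrite (_ : K = setT) ?cardsT; [lia | apply/setP=> x; rewrite allK inE].
have cim : #|isolate K (fun=> tt) @: [set: T]| = k.
  have im1 (A : {set T}) : x \in A -> (fun=> tt) @: A = [set: unit].
    move=> Ax; apply/setP=> -[]; rewrite !inE.
    by apply/imsetP; exists x.
  by rewrite card_isolate ?subsetT ?im1 ?inE ?nKx // cardsT card_unit cK; lia.
have [g Gg inj] := etS _ _ cim; exists g^-1%g; first by rewrite groupV.
have imS : isolate K (fun=> tt) @: (g @: S) = isolate K (fun=> tt) @: [set: T].
  apply/eqP; rewrite eqEcard imsetS ?subsetT //= cim card_in_imset //.
  by rewrite card_imset ?cS //; apply: perm_inj.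
apply/subsetP=> _ /imsetP[y Ky ->].
have : isolate K (fun=> tt) y \in isolate K (fun=> tt) @: (g @: S).
  by rewrite imS imset_f ?inE.
case/imsetP=> _ /imsetP[s Ss ->]; rewrite {1}/isolate Ky /isolate.
by case: ifP => // _ [->]; rewrite permK.
Qed.

Lemma k_et_section (T U : finType) (k : nat) (G : {group {perm T}})
    (f : T -> U) :
  k_et k G -> #|f @: [set: T]| = k ->
  exists S, [/\ et_witness k G S, {in S &, injective f}
                & f @: S = f @: [set: T]].
Proof.
move=> /k_et_witness[S wS] cf; have [g Gg injf] := wS.2 _ f cf.
have wgS := et_witness_act wS Gg; exists (g @: S); split=> //.
by apply/eqP; rewrite eqEcard imsetS ?subsetT //= cf card_in_imset // wgS.1.
Qed.

(** Surjectivity of the section on the values of [f] comes from counting. *)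
Lemma k_et_section_cover (T U : finType) (k : nat) (G : {group {perm T}})
    (f : T -> U) :
  k_et k G -> 0 < k -> #|f @: [set: T]| = k ->
  exists S : {set T}, [/\ #|S| = k, {in S &, injective f},
    forall x, exists2 s, s \in S & f s = f x &
    forall K : {set T}, #|K| = k.-1 ->
      exists2 g : {perm T}, g \in G & g @: K \subset S].
Proof.
move=> etG k_gt0 cf; have [S [wS injf imf]] := k_et_section etG cf.
exists S; split=> //; first exact: wS.1.
  move=> x; have /imsetP[s Ss fx] : f x \in f @: S by rewrite imf imset_f ?inE.
  by exists s.
by move=> K; apply: et_witness_cover wS _; rewrite k_gt0 -cf -cardsT leq_imset_card.
Qed.

(** * Intransitive groups *)

(** Cover a largest possible subset of [A] of size less than [k]: its translates
    stay inside [A]. *)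
Lemma et_witness_invariant (T : finType) (k : nat) (G : {group {perm T}})
    (S A : {set T}) :
  et_witness k G S -> 0 < k <= #|T| -> [acts G, on A | 'P] ->
  minn k.-1 #|A| <= #|S :&: A|.
Proof.
move=> wS k_bnd actA.
have [||L [_ sLA cL]] := @exists_set_between _ set0 A (minn k.-1 #|A|).
- exact: sub0set.
- by rewrite cards0 /= geq_minr.
have [||K [sLK _ cK]] := @exists_set_between _ L [set: T] k.-1.
- exact: subsetT.
- by rewrite cardsT cL geq_minl; case/andP: k_bnd => _; apply: leq_trans (leq_pred k).
have [g Gg sgK] := et_witness_cover wS k_bnd cK.
rewrite -cL -(card_imset (mem L) (@perm_inj _ g)); apply: subset_leq_card.
rewrite subsetI (subset_trans (imsetS g sLK) sgK) /=.
apply/subsetP=> _ /imsetP[x Lx ->].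
by have := acts_act actA Gg x; rewrite /= apermE => ->; apply: (subsetP sLA).
Qed.

(** The witness contains the fixed point, so all [k.-1]-subsets of the rest have
    to be moved onto the same set, namely the remaining points of the witness. *)
Lemma et_witness_fixed_point (T : finType) (k : nat) (G : {group {perm T}})
    (S A : {set T}) :
  et_witness k G S -> 1 < k <= #|T| -> [acts G, on A | 'P] -> #|A| = 1 ->
  exists2 a : T, a \in ('Fix_('P)(G))%g & homogeneous k.-1 G [set~ a].
Proof.
move=> wS k_bnd actA /eqP/cards1P[a defA]; move: actA; rewrite {}defA => acta.
have k_bnd' : 0 < k <= #|T| by lia.
have fixa g : g \in G -> g a = a.
  by move=> Gg; have := acts_act acta Gg a; rewrite /= apermE !inE eqxx => /eqP.
exists a; first by apply/afixP=> g Gg; rewrite /= apermE fixa.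
have Sa : a \in S.
  have := et_witness_invariant wS k_bnd' acta; rewrite cards1.
  have [-> | [x]] := set_0Vmem (S :&: [set a]); first by rewrite cards0; lia.
  by rewrite !inE => /andP[Sx /eqP<-].
have moveK (K : {set T}) : K \subset [set~ a] -> #|K| = k.-1 ->
    exists2 g, g \in G & g @: K = S :\ a.
  move=> sKa cK; have [g Gg sgK] := et_witness_cover wS k_bnd' cK.
  exists g => //; apply/eqP; rewrite eqEcard subsetD1 sgK /=.
  rewrite card_imset ?cK; last exact: perm_inj.
  have := cardsD1 a S; rewrite Sa wS.1 => cS; apply/andP; split; last lia.
  apply/imsetP=> -[x Kx]; rewrite -{1}(fixa g Gg) => /perm_inj ax.
  by have := subsetP sKa x Kx; rewrite !inE -ax eqxx.
have cSa : #|S :\ a| = k.-1 by have := cardsD1 a S; rewrite Sa wS.1; lia.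
apply/imsetP; exists (S :\ a).
  by rewrite inE cSa eqxx setDE subsetIr.
apply/setP=> K; rewrite inE; apply/andP/imsetP => [[sKa /eqP cK] | [g Gg ->]].
  have [g Gg <-] := moveK K sKa cK; exists g^-1%g; first by rewrite groupV.
  rewrite setact_perm -imset_comp -[LHS]imset_id.
  by apply: eq_imset => x /=; rewrite permK.
rewrite card_setact cSa eqxx setact_perm; split=> //.
apply/subsetP=> _ /imsetP[x /setD1P[nax _] ->].
by rewrite !inE -(fixa g Gg) (inj_eq perm_inj).
Qed.

(** Split the domain into two invariant sets. The witness meets each in at least
    the lesser of [k.-1] and its size; as [k] is less than the degree, one of the
    two has at least [k.-1] points in the witness, which leaves at most one for
    the other. As [k.-1] is at least 2, that other set is a single point. *)
Lemma intransitive_k_et (T : finType) (k : nat) (G : {group {perm T}}) :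
  ~~ [transitive G, on [set: T] | 'P] -> 2 < k < #|T| -> k_et k G ->
  exists2 a : T, a \in ('Fix_('P)(G))%g & homogeneous k.-1 G [set~ a].
Proof.
move=> ntrG /andP[k_gt2 ltkn] /k_et_witness[S wS].
have [x _] : exists x : T, x \in T by apply/card_gt0P; exact: leq_ltn_trans ltkn.
have k_bnd : 1 < k <= #|T| by rewrite (ltnW ltkn) ltnW.
have k_bnd' : 0 < k <= #|T| by rewrite (ltnW ltkn) andbT; lia.
pose A := orbit 'P G x.
have actA : [acts G, on A | 'P] by apply/actsP=> g Gg y; rewrite orbit_actr.
have actCA : [acts G, on ~: A | 'P] by rewrite astabsC.
have A_gt0 : 0 < #|A| by apply/card_gt0P; exists x; apply: orbit_refl.
have CA_gt0 : 0 < #|~: A|.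
  rewrite card_gt0; apply: contraNneq ntrG => CA0.
  apply/imsetP; exists x; rewrite ?inE //.
  by rewrite -[LHS]setC0 -CA0 setCK.
have leA := et_witness_invariant wS k_bnd' actA.
have leCA := et_witness_invariant wS k_bnd' actCA.
have cS := cardsID A S; rewrite setDE wS.1 in cS.
have cT := cardsC A.
have [cA1 | ncA1] := eqVneq #|A| 1.
  exact: et_witness_fixed_point wS k_bnd actA cA1.
apply: et_witness_fixed_point wS k_bnd actCA _.
move: leA leCA cS cT ncA1; rewrite /minn.
case: ifP => ?; case: ifP => ?; lia.
Qed.

(** Every partition has a section through [a], and homogeneity moves any two
    [k]-sets through [a] onto each other. *)
Lemma homogeneous_k_et (T : finType) (k : nat) (G : {group {perm T}}) (a : T) :
  0 < k -> a \in ('Fix_('P)(G))%g -> homogeneous k.-1 G [set~ a] -> k_et k G.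
Proof.
move=> k_gt0 /afixP fixa homG.
have /imsetP[S0] := homG; rewrite inE => /andP[sS0a /eqP cS0] _.
have nS0a : a \notin S0 by apply/negP=> /(subsetP sS0a); rewrite !inE eqxx.
exists (a |: S0); split=> [|P /andP[partP /eqP cP]].
  by rewrite cardsU1 nS0a cS0; lia.
pose r := transversal_repr a (transversal P [set: T]).
have trP := transversalP partP.
have [/eqP covP tiP _] := and3P partP.
(* A section through [a], obtained by correcting an arbitrary one. *)
pose X := (fun B : {set T} => if a \in B then a else r B) @: P.
have rB B : B \in P -> (if a \in B then a else r B) \in B.
  by move=> PB; case: ifP => // _; apply: (repr_mem_pblock trP).
have trX : is_transversal X P [set: T].
  apply/and3P; split; rewrite ?subsetT //.
  apply/forall_inP=> B PB; apply/cards1P; exists (if a \in B then a else r B).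
  apply/setP=> x; rewrite !inE; apply/andP/eqP=> [[/imsetP[C PC ->] BrC] | ->].
    by rewrite -(def_pblock tiP PB BrC) (def_pblock tiP PC (rB C PC)).
  by split; [apply: imset_f | apply: rB].
have Xa : a \in X.
  by apply/imsetP; exists (pblock P a); rewrite ?pblock_mem ?mem_pblock ?covP ?inE.
have cX : #|X| = k by rewrite (card_transversal trX).
have XaD : X :\ a \in [set A : {set T} | A \subset [set~ a] & #|A| == k.-1].
  by rewrite inE setDE subsetIr; have := cardsD1 a X; rewrite Xa setDE cX; lia.
have S0D : S0 \in [set A : {set T} | A \subset [set~ a] & #|A| == k.-1].
  by rewrite inE sS0a cS0 /=.
have [g Gg defX] := atransP2 homG S0D XaD; exists g => //.
suff -> : 'P^*%act (a |: S0) g = X by [].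
rewrite setact_perm imsetU1 -setact_perm -defX.
by have := fixa g Gg; rewrite /= apermE => ->; rewrite setD1K.
Qed.

(** * Imprimitive groups *)

Section InvariantKernel.

(** Blocks are given as the fibres of a function [b], with no partition axioms to
    carry; [b] itself need not be invariant, only its fibres are permuted. *)
Variables (T U : finType) (G : {group {perm T}}) (b : T -> U) (k : nat).
Hypothesis inv_b :
  forall (g : {perm T}) x y, g \in G -> (b (g x) == b (g y)) = (b x == b y).
Hypothesis etG : k_et k G.
Hypothesis pair_b : forall x, exists2 y, x != y & b x = b y.
Variables u v w w' : T.
Hypotheses (nuv : u != v) (buv : b u = b v).
Hypotheses (nww' : w != w') (bww' : b w = b w') (nbuw : b u != b w).

Let l := #|b @: [set: T]|.
Let B := [set x | b x == b u].

(** If there are at least [k] blocks, group them into [k] parts: the sections then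
    have at most one point in each block, and cannot cover two points of the same
    block. *)
Lemma k_et_block_count_lt : 2 < k -> l < k.
Proof.
move=> k_gt2; rewrite ltnNge; apply/negP=> lekl.
have [||Y [_ sYb cY]] := @exists_set_between _ set0 (b @: [set: T]) k.-1.
- exact: sub0set.
- by rewrite cards0 /= -/l; lia.
have [z bz nYz] : exists2 z, z \in b @: [set: T] & z \notin Y.
  apply/subsetPn; apply: contraL lekl => /subset_leq_card; rewrite cY -/l; lia.
pose f := isolate Y (fun=> tt) \o b.
have im1 (A : {set U}) : z \in A -> (fun=> tt) @: A = [set: unit].
  by move=> Az; apply/setP=> -[]; rewrite inE; apply/imsetP; exists z.
have cf : #|f @: [set: T]| = k.
  rewrite imset_comp card_isolate // ?im1 ?inE ?nYz // cardsT card_unit cY; lia.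
have [|S [_ injf _ cover]] := k_et_section_cover etG _ cf; first by lia.
have [n nE] : exists n, #|T| = n by exists #|T|.
have [||K [sK _ cK]] := @exists_set_between _ [set u; v] [set: T] k.-1.
- exact: subsetT.
- rewrite cards2 nuv cardsT nE; have := leq_imset_card b [set: T].
  by rewrite -/l cardsT nE; lia.
have [g Gg sgK] := cover K cK.
have : g u = g v.
  apply: injf; try by apply/(subsetP sgK)/imset_f/(subsetP sK); rewrite !inE eqxx ?orbT.
  by rewrite /f /= (_ : b (g u) = b (g v)) //; apply/eqP; rewrite inv_b // buv.
by move/perm_inj/eqP; apply/negP.
Qed.

(** Choose a partition with at least two parts inside [B] and two outside. No
    section of it has all but one of its points in one block, but a block with
    [k.-1] points forces such sections. *)
Lemma k_et_block_size_lt : 3 < k -> k.+1 < #|T| -> #|B| < k.-1.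
Proof.
move=> k_gt3 ltkT; rewrite ltnNge; apply/negP=> leB.
have [Bu Bv nBw nBw'] : [/\ u \in B, v \in B, w \notin B & w' \notin B].
  by rewrite !inE -buv -bww' eqxx eq_sym nbuw.
have memneq (A : {set T}) x y : x \in A -> y \notin A -> x != y.
  by move=> Ax; apply: contraNneq => <-.
have [||X [sX sXC cX]] := @exists_set_between _ [set u; w] (~: [set v; w']) (k - 2).
- apply/subsetP=> x; rewrite !inE negb_or => /orP[] /eqP->.
    by rewrite nuv (memneq _ _ _ Bu nBw').
  by rewrite nww' eq_sym (memneq _ _ _ Bv nBw).
- have [n nE] : exists n, #|T| = n by exists #|T|.
  rewrite !cards2 (memneq _ _ _ Bu nBw).
  have := cardsC [set v; w']; rewrite cards2 (memneq _ _ _ Bv nBw').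
  by move: ltkT; rewrite !nE; lia.
have [Xu Xw] : u \in X /\ w \in X.
  by split; apply: (subsetP sX); rewrite !inE eqxx ?orbT.
have [nXv nXw'] : v \notin X /\ w' \notin X.
  by split; apply/negP=> /(subsetP sXC); rewrite !inE eqxx ?orbT.
pose f := isolate X (mem B).
have imB (A : {set T}) : v \in A -> w' \in A -> mem B @: A = [set: bool].
  move=> Av Aw'; apply/setP=> -[]; rewrite inE; apply/imsetP.
    by exists v; rewrite //= Bv.
  by exists w'; rewrite //= (negPf nBw').
have cf : #|f @: [set: T]| = k.
  rewrite card_isolate ?subsetT //; last by rewrite (imB setT) ?imB ?inE ?nXv ?nXw'.
  by rewrite imB ?inE // cardsT card_bool cX subnK ?(ltnW (ltnW k_gt3)).
have [|S [cS injf surjf cover]] := k_et_section_cover etG _ cf.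
  by apply: ltn_trans k_gt3.
have inX x : x \in X -> x \in S.
  move=> Xx; have [s Ss] := surjf x; rewrite /f /isolate Xx.
  by case: ifP => // _ [<-].
have offX x : x \notin X -> exists s, [/\ s \in S, s \notin X & (s \in B) = (x \in B)].
  move=> nXx; have [s Ss] := surjf x; rewrite /f /isolate (negPf nXx).
  by case: ifP => // nXs [Bs]; exists s; rewrite nXs.
have [s [Ss nXs Bs]] := offX v nXv; have [t [St nXt Bt]] := offX w' nXw'.
have [||K [_ sKB cK]] := @exists_set_between _ set0 B k.-1.
- exact: sub0set.
- by rewrite cards0.
have [g Gg sgK] := cover K cK.
have cS' : #|S| = k.-1.+1 by rewrite cS (ltn_predK k_gt3).
have gB y : y \in g @: K -> b y == b (g u).
  by move=> /imsetP[z /(subsetP sKB)]; rewrite inE => bz ->; rewrite inv_b.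
(* [g @: K] lies in the block of [g u], and [B] and its complement each contain
   two points of [S]: either [B] or its complement misses that block. *)
have [gu | gu] := boolP (g u \in B).
  suff wt : w = t by move: nXt; rewrite -wt Xw.
  apply: (setD_imset_unique cS' cK sgK) => //; first exact: inX.
    apply: contra nBw => /gB /eqP bw; rewrite inE bw.
    by move: gu; rewrite inE.
  rewrite Bv in Bs; rewrite (negPf nBw') in Bt.
  apply/negP=> /gB /eqP bt; move: Bt; rewrite inE bt.
  by move: gu; rewrite inE => ->.
suff us : u = s by move: nXs; rewrite -us Xu.
apply: (setD_imset_unique cS' cK sgK) => //; first exact: inX.
  apply: contra gu => /gB; by rewrite inE eq_sym.
rewrite Bv in Bs; apply/negP=> /gB /eqP bs; move: Bs; rewrite inE bs.
by move: gu; rewrite inE => /negPf->.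
Qed.

(** In the next lemma, points outside [R] are isolated, so that no block is
    exhausted; the two cases there are whether they can be chosen outside [D] as
    well, or can be made to include all the points outside [D]. *)
Lemma two_points_per_block : exists D R : {set T},
  [/\ R \subset D, #|R| = l, #|D| = l + l, b @: R = b @: [set: T] &
   (forall x, exists p q, [/\ p != q, b p = b x, b q = b x &
              forall d, (d \in D) && (b d == b x) = (d \in [set p; q])])].
Proof.
pose r z := odflt u [pick x | b x == z].
pose r' z := odflt u [pick x | (b x == z) && (x != r z)].
have br x : b (r (b x)) = b x.
  by rewrite /r; case: pickP => [y /eqP//|/(_ x)]; rewrite eqxx.
have br' x : b (r' (b x)) = b x /\ r' (b x) != r (b x).
  rewrite /r'; case: pickP => [y /andP[/eqP]//|none]; have [y nxy bxy] := pair_b x.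
  have := none x; have := none y; rewrite -bxy eqxx /= => /eqP yr /eqP xr.
  by case/eqP: nxy; rewrite xr yr.
pose R := r @: (b @: [set: T]); pose R' := r' @: (b @: [set: T]).
have inR x : (x \in R) = (x == r (b x)).
  apply/imsetP/eqP=> [[_ /imsetP[y _ ->] ->] | {1}->]; first by rewrite br.
  by exists (b x); rewrite ?imset_f ?inE.
have inR' x : (x \in R') = (x == r' (b x)).
  apply/imsetP/eqP=> [[_ /imsetP[y _ ->] ->] | {1}->]; first by rewrite (br' y).1.
  by exists (b x); rewrite ?imset_f ?inE.
have cR : #|R| = l.
  apply: card_in_imset => _ _ /imsetP[x _ ->] /imsetP[y _ ->] /(congr1 b).
  by rewrite !br.
have cR' : #|R'| = l.
  apply: card_in_imset => _ _ /imsetP[x _ ->] /imsetP[y _ ->] /(congr1 b).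
  by rewrite (br' x).1 (br' y).1.
exists (R :|: R'), R; split=> //; first exact: subsetUl.
- rewrite cardsU disjoint_setI0 ?cards0 ?cR ?cR' ?subn0 //.
  rewrite disjoints_subset; apply/subsetP=> x; rewrite inE inR inR' => /eqP xr.
  by rewrite eq_sym {2}xr (br' x).2.
- rewrite /R -imset_comp -[RHS]imset_id.
  by apply: eq_in_imset => _ /imsetP[x _ ->] /=; rewrite br.
move=> x; exists (r (b x)), (r' (b x)); have [bq nqp] := br' x.
split; rewrite ?br ?(eq_sym (r _)) // => d; rewrite !inE inR inR'.
apply/andP/orP=> [[dD /eqP <-] | [/eqP-> | /eqP->]]; first exact/orP.
  by rewrite br !eqxx.
by rewrite bq !eqxx orbT.
Qed.

(** Take [k - l] singleton parts, the [l] other parts being what is left of the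
    blocks. Depending on whether these singletons can avoid two points of each
    block, a section either contains no block or misses at most one point of
    each block. The former fails to cover a block, which has less than [k.-1]
    points; the latter fails to leave out two points in each of two blocks. *)
Lemma k_et_no_invariant_kernel : 3 < k -> k + 2 < #|T| -> False.
Proof.
move=> k_gt3 ltkT.
(* An opaque name for the degree, for the sake of linear arithmetic. *)
have [n nE] : exists n, #|T| = n by exists #|T|.
have ltlk : l < k by apply: k_et_block_count_lt; lia.
have ltBk : #|B| < k.-1 by apply: k_et_block_size_lt; move: ltkT; rewrite ?nE; lia.
have [D [R [sRD cR cD bR DP]]] := two_points_per_block.
have cDC : #|D| + #|~: D| = n by rewrite cardsC nE.
have cRC : #|R| + #|~: R| = n by rewrite cardsC nE.
rewrite nE in ltkT.
have isoX (X : {set T}) : X \subset ~: R -> #|X| = k - l ->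
  #|isolate X b @: [set: T]| = k.
  move=> sX cX; rewrite card_isolate ?subsetT // -/l ?cX; first by lia.
  apply/eqP; rewrite eqEsubset imsetS ?subsetT //= -bR imsetS //.
  by rewrite setTD -setCS setCK.
have sDR : ~: D \subset ~: R by rewrite setCS.
(* Few singleton parts: no block is contained in the section. *)
have [leD | ltD] := leqP (k - l) #|~: D|.
  have [||X [_ sXD cX]] := @exists_set_between _ set0 (~: D) (k - l).
  - exact: sub0set.
  - by rewrite cards0.
  have cf := isoX X (subset_trans sXD sDR) cX.
  have [|S [_ injf _ cover]] := k_et_section_cover etG _ cf; first by lia.
  have [||K [sBK _ cK]] := @exists_set_between _ B [set: T] k.-1.
  - exact: subsetT.
  - by rewrite cardsT nE; lia.
  have [g Gg sgK] := cover K cK; have [p [q [npq bp bq pq]]] := DP (g u).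
  have inS x : b x = b (g u) -> x \in S.
    move=> bx; apply: (subsetP sgK); rewrite -(permKV g x); apply: imset_f.
    by apply: (subsetP sBK); rewrite inE -(inv_b _ _ Gg) permKV bx.
  have offX x : x \in [set p; q] -> x \notin X.
    by rewrite -pq => /andP[Dx _]; apply/negP=> /(subsetP sXD); rewrite inE Dx.
  case/eqP: npq; apply: injf; rewrite ?inS // /isolate.
  by rewrite !(negPf (offX _ _)) ?inE ?eqxx ?orbT // bp bq.
(* Many singleton parts: the section misses at most one point per block. *)
have [||X [sDX sXR cX]] := @exists_set_between _ (~: D) (~: R) (k - l) => //.
  by rewrite ltnW //=; lia.
have cf := isoX X sXR cX.
have [|S [cS _ surjf cover]] := k_et_section_cover etG _ cf; first by lia.
have misses x y : x != y -> b x = b y -> (x \in S) || (y \in S).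
  move=> nxy bxy.
  have inX z : z \in X -> z \in S.
    move=> Xz; have [s Ss] := surjf z; rewrite /isolate Xz.
    by case: ifP => // _ [<-].
  have [Xx | nXx] := boolP (x \in X); first by rewrite inX.
  have [Xy | nXy] := boolP (y \in X); first by rewrite (inX y) ?orbT.
  have [s Ss] := surjf x; rewrite /isolate (negPf nXx); case: ifP => // /negbT nXs [bs].
  have inD z : z \notin X -> z \in D.
    by move=> nXz; apply: contraR nXz => nDz; apply: (subsetP sDX); rewrite inE.
  have [p [q [npq _ _ pq]]] := DP x.
  have /set2P xE : x \in [set p; q] by rewrite -pq inD ?eqxx.
  have /set2P yE : y \in [set p; q] by rewrite -pq inD // bxy eqxx.
  have /set2P sE : s \in [set p; q] by rewrite -pq inD // bs eqxx.
  suff /orP[] : (s == x) || (s == y) by move=> /eqP<-; rewrite Ss ?orbT.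
  by move: nxy; case: xE => ->; case: yE => ->; case: sE => ->; rewrite !eqxx ?orbT.
have nmem x y : b x = b u -> b y = b w -> x != y.
  by move=> bx by_; apply: contraNneq nbuw => xy; rewrite -bx xy by_.
(* A set avoiding two points in each of two blocks; this fits because n - k is
   at least 3. *)
have [||K [_ sK cK]] := @exists_set_between _ set0 (~: [set:: [:: u; v; w; w']]) k.-1.
- exact: sub0set.
- have := cardsC [set:: [:: u; v; w; w']]; rewrite nE cards0 cardsE.
  rewrite (card_uniqP _) /=; first by lia.
  by rewrite !inE !negb_or nuv nww' !nmem -?buv -?bww'.
have [g Gg sgK] := cover K cK.
have cS' : #|S| = k.-1.+1 by rewrite cS (ltn_predK k_gt3).
have off x : x \in [:: u; v; w; w'] -> g x \notin g @: K.
  move=> x4; rewrite (mem_imset _ _ perm_inj); apply/negP=> /(subsetP sK).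
  by rewrite !inE; move: x4; rewrite !inE => ->.
have one x y : x \in [:: u; v; w; w'] -> y \in [:: u; v; w; w'] -> x != y -> b x = b y ->
    exists z, [/\ z \in [:: x; y], g z \in S & g z \notin g @: K].
  move=> x4 y4 nxy bxy; have /orP[] : (g x \in S) || (g y \in S).
  - by apply: misses; [rewrite (inj_eq perm_inj) | apply/eqP; rewrite inv_b // bxy].
  - by move=> Sx; exists x; split=> //; [rewrite !inE eqxx | apply: off].
  - by move=> Sy; exists y; split=> //; [rewrite !inE eqxx orbT | apply: off].
have [|||| z [zE Sz nz]] := one u v; rewrite ?inE ?eqxx ?orbT //.
have [|||| t [tE St nt]] := one w w'; rewrite ?inE ?eqxx ?orbT //.
have := setD_imset_unique cS' cK sgK Sz St nz nt => /perm_inj/eqP.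
apply/negP/nmem; first by move: zE; rewrite !inE => /orP[]/eqP->.
by move: tE; rewrite !inE => /orP[]/eqP->.
Qed.

End InvariantKernel.

Lemma k_et_primitive (T : finType) (G : {group {perm T}}) (k : nat) :
  [transitive G, on [set: T] | 'P] -> 3 < k < #|T| - 2 ->
  k_et k G -> [primitive G, on [set: T] | 'P].
Proof.
move=> trG /andP[k_gt3 ltkT] etG; apply/andP; split=> //.
apply/existsP=> -[Q /and3P[partQ actQ /andP[Q_gt1 ltQT]]].
have [/eqP covQ tiQ nQ0] := and3P partQ.
have bQ x : pblock Q x \in Q by rewrite pblock_mem // covQ inE.
have inb x : x \in pblock Q x by rewrite mem_pblock covQ inE.
have bact g x : g \in G -> pblock Q (g x) = g @: pblock Q x.
  move=> Gg; apply: def_pblock => //; last by apply: imset_f.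
  by rewrite -setact_perm (acts_act actQ Gg).
have inv_b (g : {perm T}) x y : g \in G ->
    (pblock Q (g x) == pblock Q (g y)) = (pblock Q x == pblock Q y).
  by move=> Gg; rewrite !bact // (inj_eq (imset_inj perm_inj)).
have imQ : pblock Q @: [set: T] = Q.
  apply/setP=> C; apply/imsetP/idP=> [[x _ ->] // | QC].
  have [x Cx] : exists x, x \in C by apply/set0Pn; apply: contraNneq nQ0 => <-.
  by exists x => //; rewrite (def_pblock tiQ QC Cx).
have [x0 [y0 [_ _ nxy bxy]]] : exists x y,
    [/\ x \in [set: T], y \in [set: T], x != y & pblock Q x = pblock Q y].
  have : ~~ dinjectiveb (pblock Q) [set: T].
    apply/negP=> /dinjectiveP/card_in_imset; rewrite imQ => cQ.
    by move: ltQT; rewrite cQ ltnn.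
  by case/dinjectivePn=> x Tx [y /andP[]/= nyx Ty ?]; exists x, y; rewrite eq_sym.
have pair_b x : exists2 y, x != y & pblock Q x = pblock Q y.
  have [g Gg ->] := atransP2 trG (in_setT x0) (in_setT x).
  exists (g y0); rewrite /= apermE ?(inj_eq perm_inj) //.
  by apply/eqP; rewrite inv_b // bxy.
have [C [D [QC QD nCD]]] := card_gt1P Q_gt1.
move: QC QD nCD; rewrite -imQ => /imsetP[u _ ->] /imsetP[w _ ->] nuw.
have [v nuv buv] := pair_b u; have [w' nww' bww'] := pair_b w.
by apply: (k_et_no_invariant_kernel inv_b etG pair_b nuv buv nww' bww' nuw); lia.
Qed.

(** * Invariant graphs *)

(** The usual neighbourhood recursion: a vertex has either many neighbours or many
    non-neighbours in [A]. *)
Lemma ramsey_graph (s t : nat) :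
  exists N, forall (T : finType) (e : rel T) (A : {set T}),
    symmetric e -> N <= #|A| ->
    (exists2 K : {set T}, K \subset A /\ #|K| = s &
       {in K &, forall x y, x != y -> e x y}) \/
    (exists2 K : {set T}, K \subset A /\ #|K| = t &
       {in K &, forall x y, x != y -> ~~ e x y}).
Proof.
have empty (T : finType) (A : {set T}) (P : rel T) :
    exists2 K : {set T}, K \subset A /\ #|K| = 0 & {in K &, forall x y, P x y}.
  by exists set0; rewrite ?sub0set ?cards0 // => x y; rewrite inE.
elim: s t => [|s IHs] t; first exists 0.
  by move=> T e A _ _; left; have [K] := empty T A (fun x y => (x != y) ==> e x y);
    move=> ? eK; exists K => // x y Kx Ky; apply/implyP/eK.
elim: t => [|t [N2 IHt]]; first exists 0.
  by move=> T e A _ _; right; have [K] := empty T A (fun x y => (x != y) ==> ~~ e x y);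
    move=> ? eK; exists K => // x y Kx Ky; apply/implyP/eK.
have [N1 {}IHs] := IHs t.+1.
exists (N1 + N2).+1 => T e A sym_e leA.
have extend (f : rel T) (x : T) (K : {set T}) : symmetric f ->
    {in K, forall y, f x y} -> {in K &, forall y z, y != z -> f y z} ->
    {in x |: K &, forall y z, y != z -> f y z}.
  move=> sym_f fx fK y z /setU1P[->|Ky] /setU1P[->|Kz]; rewrite ?eqxx //.
  - by move=> _; apply: fx.
  - by move=> _; rewrite sym_f; apply: fx.
  - exact: fK.
have [x Ax] : exists x, x \in A by apply/card_gt0P; lia.
pose A1 := [set y in A :\ x | e x y]; pose A2 := [set y in A :\ x | ~~ e x y].
have cA : #|A1| + #|A2| = #|A :\ x|.
  rewrite -(cardsID [set y | e x y] (A :\ x)).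
  by congr (_ + _); apply: eq_card => y; rewrite !inE // andbC.
have cAx := cardsD1 x A; rewrite Ax in cAx.
have sub1 (f : pred T) (K : {set T}) : K \subset [set y in A :\ x | f y] ->
    [/\ x |: K \subset A, x \notin K & {in K, forall y, f y}].
  move=> sK; split.
  - rewrite subUset sub1set Ax; apply: subset_trans sK _.
    by apply/subsetP=> y; rewrite !inE => /andP[/andP[]].
  - by apply/negP=> /(subsetP sK); rewrite !inE eqxx.
  - by move=> y /(subsetP sK); rewrite !inE => /andP[].
have [leA1 | ltA1] := leqP N1 #|A1|.
  have [[K [sKA1 cK] eK] | [K [sKA1 cK] eK]] := IHs T e A1 sym_e leA1.
    have [sKA nKx ex] := sub1 _ _ sKA1; left; exists (x |: K).
      by rewrite cardsU1 nKx cK.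
    exact: extend.
  have [sKA nKx _] := sub1 _ _ sKA1; right; exists K => //; split=> //.
  exact: subset_trans (subsetUr _ _) sKA.
have leA2 : N2 <= #|A2| by lia.
have [[K [sKA2 cK] eK] | [K [sKA2 cK] eK]] := IHt T e A2 sym_e leA2.
  have [sKA nKx _] := sub1 _ _ sKA2; left; exists K => //; split=> //.
  exact: subset_trans (subsetUr _ _) sKA.
have [sKA nKx ex] := sub1 _ _ sKA2; right; exists (x |: K).
  by rewrite cardsU1 nKx cK.
by apply: (extend (fun y z => ~~ e y z)) => // y z; rewrite sym_e.
Qed.

(** If all edges met the edge [x y], two vertices outside it would have all their
    neighbours in it. By regularity this makes the degree at once at most 2 and,
    at [x], at least 3. *)
Lemma transitive_graph_disjoint_edges (T : finType) (G : {group {perm T}})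
    (e : rel T) (x y : T) :
  [transitive G, on [set: T] | 'P] -> 3 < #|T| ->
  symmetric e -> irreflexive e ->
  (forall (g : {perm T}) u v, g \in G -> e (g u) (g v) = e u v) -> e x y ->
  exists z w u v, [/\ e z w, e u v & uniq [:: z; w; u; v]].
Proof.
move=> trG T_gt3 sym_e irr_e inv_e exy.
pose N u := [set v | e u v].
have cN u v : #|N u| = #|N v|.
  have [g Gg ->] := atransP2 trG (in_setT u) (in_setT v).
  rewrite /= apermE -(card_imset (mem (N u)) (@perm_inj _ g)).
  apply: eq_card => z; rewrite inE -[z](permKV g) inv_e //.
  by rewrite (mem_imset _ _ perm_inj) inE.
have eneq u v : e u v -> u != v by apply: contraTneq => ->; rewrite irr_e.
have [z1 [z2 [nz1 nz2 nz12]]] :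
    exists z1 z2, [/\ z1 \notin [set x; y], z2 \notin [set x; y] & z1 != z2].
  have : 1 < #|~: [set x; y]|.
    by have := cardsC [set x; y]; rewrite cards2 (eneq _ _ exy); lia.
  by case/card_gt1P=> z1 [z2]; rewrite ![_ \in ~: _]inE => -[? ? ?]; exists z1, z2.
have [/existsP[z /existsP[w]] | noedge] :=
    boolP [exists z, exists w, [&& e z w, z \notin [set x; y] & w \notin [set x; y]]].
  case/and3P=> ezw; rewrite !inE !negb_or => /andP[nzx nzy] /andP[nwx nwy].
  exists x, y, z, w; split=> //=.
  by rewrite !inE !negb_or (eneq _ _ exy) (eneq _ _ ezw) -!(eq_sym z) -!(eq_sym w)
    nzx nzy nwx nwy.
have sN z : z \notin [set x; y] -> N z \subset [set x; y].
  move=> nz; apply/subsetP=> w; rewrite inE => ezw.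
  apply: contraR noedge => nw; apply/existsP; exists z; apply/existsP; exists w.
  by rewrite ezw nz nw.
have lepair u v w : v != w -> e u v -> e u w -> 1 < #|N u|.
  by move=> nvw euv euw; apply/card_gt1P; exists v, w; rewrite !inE.
(* Counted at [z1], the common degree is at most 2; the vertex of the edge [x y]
   adjacent to [z1] has degree at least 2. *)
have [w /[!inE] ew] : exists w, w \in N z1.
  by apply/card_gt0P; rewrite (cN _ x); apply/card_gt0P; exists y; rewrite inE.
have [nxz1 nyz1] : x != z1 /\ y != z1.
  by move: nz1; rewrite !inE negb_or ![z1 == _]eq_sym => /andP[].
have gt1 : 1 < #|N x|.
  have /set2P[wE|wE] : w \in [set x; y] by apply: (subsetP (sN _ nz1)); rewrite inE.
    by apply: (@lepair x y z1) => //; rewrite sym_e -wE.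
  by rewrite (cN x y); apply: (@lepair y x z1) => //; rewrite sym_e // -wE.
have NzE z : z \notin [set x; y] -> e x z.
  move=> nz; rewrite sym_e; have /eqP/setP/(_ x) : N z == [set x; y].
    by rewrite eqEcard sN //= cards2 (eneq _ _ exy) (cN z x).
  by rewrite !inE eqxx.
(* So z1 and z2 are both adjacent to x, and so is y. *)
have : 2 < #|N x|.
  apply/card_gt2P; exists y, z1, z2; rewrite !inE exy !NzE //; split=> //; split=> //.
  by move: nz2; rewrite !inE negb_or => /andP[].
have := subset_leq_card (sN _ nz1); rewrite (cN z1 x) cards2 (eneq _ _ exy).
by lia.
Qed.

(** The witness contains a copy of the clique, hence is a clique and one more
    point. It cannot contain two disjoint non-edges; but if there is a non-edge
    there are two disjoint ones, and they fit in a set of size [k.-1], which is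
    at least 4, that the witness has to cover. *)
Lemma et_witness_clique_complete (T : finType) (k : nat) (G : {group {perm T}})
    (S K : {set T}) (e : rel T) (x y : T) :
  4 < k <= #|T| -> et_witness k G S -> [transitive G, on [set: T] | 'P] ->
  symmetric e ->
  (forall (g : {perm T}) u v, g \in G -> e (g u) (g v) = e u v) ->
  #|K| = k.-1 -> {in K &, forall u v, u != v -> e u v} -> x != y -> e x y.
Proof.
move=> /andP[k_gt4 lekT] wS trG sym_e inv_e cK eK nxy.
apply: contraT => nexy; pose e' u v := (u != v) && ~~ e u v.
have k_bnd : 0 < k <= #|T| by rewrite lekT andbT; lia.
have [z [w [u [v [ezw euv uniq4]]]]] :
    exists z w u v, [/\ e' z w, e' u v & uniq [:: z; w; u; v]].
  apply: (@transitive_graph_disjoint_edges T G e' x y) => //.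
  - by apply: leq_trans lekT; lia.
  - by move=> u v; rewrite /e' eq_sym sym_e.
  - by move=> u; rewrite /e' eqxx.
  - by move=> g u v Gg; rewrite /e' inv_e // (inj_eq perm_inj).
  - by rewrite /e' nxy.
have [||L [sL _ cL]] := @exists_set_between _ [set:: [:: z; w; u; v]] [set: T] k.-1.
- exact: subsetT.
- rewrite cardsT cardsE (card_uniqP uniq4) /=; apply/andP; split; first lia.
  exact: leq_trans (leq_pred k) lekT.
have [g Gg sgK] := et_witness_cover wS k_bnd cK.
have [h Gh shL] := et_witness_cover wS k_bnd cL.
have cS : #|S| = k.-1.+1 by rewrite wS.1 (ltn_predK k_gt4).
(* As [g @: K] is a clique, one end of each non-edge falls outside it. *)
have out p q : p \in L -> q \in L -> e' p q ->
    h p \in S :\: g @: K \/ h q \in S :\: g @: K.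
  move=> Lp Lq /andP[npq nepq].
  have Sh r : r \in L -> h r \in S by move=> Lr; apply: (subsetP shL); apply: imset_f.
  rewrite !in_setD !Sh // !andbT; apply/orP; rewrite -negb_and.
  apply: contra nepq => /andP[/imsetP[p' Kp' def_p] /imsetP[q' Kq' def_q]].
  rewrite -(inv_e h) // def_p def_q inv_e //; apply: eK => //.
  apply: contraNneq npq => eqpq; apply/eqP/(@perm_inj _ h).
  by rewrite def_p def_q eqpq.
have in4 p : p \in [:: z; w; u; v] -> p \in L by move=> ?; apply: (subsetP sL); rewrite inE.
have one p q : (h p \notin g @: K) && (h p \in S) ->
    (h q \notin g @: K) && (h q \in S) -> p = q.
  move=> /andP[np Sp] /andP[nq Sq]; apply: (@perm_inj _ h).
  exact: setD_imset_unique cS cK sgK Sp Sq np nq.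
move: uniq4; rewrite /= !inE !negb_or andbT => /and3P[/and3P[_ nzu nzv] /andP[nwu nwv] _].
have [] := out z w _ _ ezw; rewrite ?in4 ?inE ?eqxx ?orbT // => h1;
have [] := out u v _ _ euv; rewrite ?in4 ?inE ?eqxx ?orbT // => h2;
by move: (one _ _ h1 h2) nzu nzv nwu nwv => ->; rewrite eqxx.
Qed.

(** Make an orbit on pairs into a graph. By Ramsey, the graph or its complement
    has a clique of size [k.-1], and so is complete. As the orbit is not empty it
    is not the complement that is complete. *)
Lemma large_k_et_2_homogeneous (k : nat) : 4 < k ->
  exists N : nat, forall (T : finType) (G : {group {perm T}}),
    N <= #|T| -> k <= #|T| -> [transitive G, on [set: T] | 'P] -> k_et k G ->
    homogeneous 2 G [set: T].
Proof.
move=> k_gt4; have [N ram] := ramsey_graph k.-1 k.-1.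
exists N => T G leNT lekT trG /k_et_witness[S wS].
have k_bnd : 4 < k <= #|T| by rewrite k_gt4.
have [x0 [y0 [_ _ n0]]] : exists x y, [/\ x \in T, y \in T & x != y].
  by apply/card_gt1P; apply: leq_trans lekT; lia.
pose e x y := [set x; y] \in orbit 'P^* G [set x0; y0].
have sym_e : symmetric e by move=> x y; rewrite /e setUC.
have inv_e (g : {perm T}) u v : g \in G -> e (g u) (g v) = e u v.
  move=> Gg; rewrite /e; have -> : [set g u; g v] = 'P^*%act [set u; v] g.
    by rewrite setact_perm imsetU !imset_set1.
  by rewrite orbit_actr.
have e0 : e x0 y0 by apply: orbit_refl.
suff all_e x y : x != y -> e x y.
  apply/imsetP; exists [set x0; y0]; first by rewrite inE subsetT cards2 n0.
  apply/setP=> A; rewrite inE subsetT /=; apply/idP/imsetP=> [|[g Gg ->]].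
    by case/cards2P=> x [y [nxy ->]]; apply/imsetP/all_e.
  by rewrite card_setact cards2 n0.
have [||[K [_ cK] eK] | [K [_ cK] eK]] := ram T e [set: T].
- exact: sym_e.
- by rewrite cardsT.
- exact: (et_witness_clique_complete k_bnd wS trG sym_e inv_e cK eK).
suff : ~~ e x0 y0 by rewrite e0.
apply: (et_witness_clique_complete (e := fun x y => ~~ e x y) k_bnd wS trG _ _ cK eK n0).
- by move=> u v; rewrite sym_e.
- by move=> g u v Gg; rewrite inv_e.
Qed.

(** * Consequences of the existential transversal property *)

Theorem theorem1p1 :
  [/\ forall (T : finType) (G : {group {perm T}}) (k : nat),
        ~~ [transitive G, on [set: T] | 'P] -> 2 < k < #|T| ->
        k_et k G <->
        exists2 a : T, a \in ('Fix_('P)(G))%g & homogeneous k.-1 G [set~ a],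
      forall (T : finType) (G : {group {perm T}}) (k : nat),
        [transitive G, on [set: T] | 'P] -> 3 < k < #|T| - 2 ->
        k_et k G -> [primitive G, on [set: T] | 'P]
    & forall k : nat, 5 <= k ->
      exists N : nat, forall (T : finType) (G : {group {perm T}}),
        N <= #|T| -> 2 * k <= #|T| ->
        [transitive G, on [set: T] | 'P] -> k_et k G ->
        homogeneous 2 G [set: T]].
Proof.
split.
- move=> T G k ntrG k_bnd; split; first exact: intransitive_k_et.
  case=> a fixa homG; apply: homogeneous_k_et fixa homG.
  by case/andP: k_bnd => /ltnW/ltnW.
- by move=> T G k; apply: k_et_primitive.
move=> k k_gt4; have [N homN] := large_k_et_2_homogeneous k_gt4.
exists N => T G leNT le2kT; apply: homN => //.
by apply: leq_trans le2kT; rewrite leq_pmull.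
Qed.
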